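(* Let $A\subset\mathbb{Z}$ be a finite nonempty set with characteristic function $\chi_A$ satisfying the sparsity condition $$\sum_{\substack{m,n\in A\\ m<n}}\frac{1}{n-m}\leq\frac{\pi}{8}|A|.$$ Then for every $k\in\mathbb{N}$ and every $p\geq 2$, $$\|\chi_A^{(k)}\|_{l^p(\mathbb{Z})}\geq (k+1)^{\frac1p-\frac12}\,2^{\frac{k}{2}-1}\,\|\chi_A\|_{l^p(\mathbb{Z})},$$ and for every $k\in\mathbb{N}$ and every $1\leq p<2$, $$\|\chi_A^{(k)}\|_{l^p(\mathbb{Z})}\geq 2^{\,k-\frac{k+2}{p}}\,\|\chi_A\|_{l^p(\mathbb{Z})}.$$
   Context: For $f:\mathbb{Z}\to\mathbb{R}$ and an integer $k\geq 1$, the discrete derivative (forward difference) of order $k$ is $f^{(k)}(n):=\sum_{j=0}^{k}\binom{k}{j}(-1)^{j}f(n+k-j)$, $n\in\mathbb{Z}$. Here $\mathbb{N}$ denotes the positive integers. *)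

(* Defs.v *)
From HB Require Import structures.
From mathcomp Require Import all_boot all_order all_algebra.
From mathcomp Require Import finmap.
From mathcomp Require Import all_classical all_reals all_analysis.

Set Implicit Arguments.
Unset Strict Implicit.
Unset Printing Implicit Defensive.
Import Order.TTheory GRing.Theory Num.Theory.

Local Open Scope classical_set_scope.
Local Open Scope ring_scope.

(* measurableType requires a pointed carrier. *)
HB.instance Definition _ := isPointed.Build int 0.

(* The discrete sigma-algebra on int, as the library has it on nat. *)
HB.instance Definition _ := @isMeasurable.Build default_measure_display
  int discrete_measurable (@discrete_measurable0 int)
  (@discrete_measurableC int) (@discrete_measurableU int).

Section Sequences.
Context {R : realType}.

Definition forward_diff (k : nat) (f : int -> R) (n : int) : R :=
  \sum_(0 <= j < k.+1) 'C(k, j)%:R * (-1) ^+ j * f (n + k%:Z - j%:Z).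

Definition lnorm (p : R) (f : int -> R) : \bar R :=
  Lnorm (@counting int R) p%:E (EFin \o f).

Definition chi (A : {fset int}) : int -> R := \1_[set` A].

End Sequences.

(* Main.v *)
Require Import Defs.
From mathcomp Require Import all_boot all_order all_algebra.
From mathcomp Require Import finmap.
From mathcomp Require Import all_classical all_reals all_analysis.
From mathcomp Require Import complex ring lra.

(** Sparsity gives the case p = 2, and the other exponents follow from
    it by interpolation.

    Case p = 2. For a finitely supported f let |F(t)|^2, with
    F(t) = sum_n f(n) e^(i n t), be its energy density. Differencing k times
    multiplies it by |1 - e^(it)|^(2k) = (2 - 2 cos t)^k
    ([energy_forward_diff]), which is at least 2^k on [pi/2, pi]. Over [0, pi]
    the density of f^(k) integrates to pi times the sum of the squares of
    f^(k), by orthogonality ([energy_primitive_pi]). Over [pi/2, pi] the density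
    of chi_A integrates to at least (pi/4) |A|: the diagonal contributes
    (pi/2) |A|, and each pair m < n of A costs at most 2 / (n - m), hence
    at most (pi/4) |A| in all by sparsity ([energy_primitive_pihalf_le]).
    Discarding the nonnegative part over [0, pi/2] gives
    sum_n f^(k)(n)^2 >= 2^(k-2) |A| ([sum_sqr_forward_diff_chi_ge]).
    Integrals of densities appear below as increments of an explicit
    antiderivative, compared by monotonicity ([energy_primitive_le]).

    Interpolation. The difference of chi_A lives on at most (k+1) |A| points, so
    for p >= 2 the power mean inequality applies ([sum_powR_ge]). For p < 2 its
    absolute value is at most 2^k, so that |x|^p >= x^2 2^(k (p - 2)) at
    each of its values x ([sum_powR_ge_bounded]). *)

Set Implicit Arguments.
Unset Strict Implicit.
Unset Printing Implicit Defensive.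
Import Order.TTheory GRing.Theory Num.Theory numFieldNormedType.Exports.

Local Open Scope ring_scope.

(** * The energy density of a difference *)

Section Fourier.
Context {R : realType}.
Implicit Types (s w : seq int) (f g : int -> R) (t : R) (k : nat).

Local Open Scope complex_scope.

Definition expi t : R[i] := cos t +i* sin t.

Lemma expiD t u : expi (t + u) = expi t * expi u.
Proof. by rewrite /expi cosD sinD; simpc; rewrite [_ * sin u + _]addrC. Qed.

Lemma expi0 : expi 0 = 1.
Proof. by rewrite /expi cos0 sin0. Qed.

Lemma expi_natM k t : expi (k%:R * t) = expi t ^+ k.
Proof.
elim: k => [|k IHk]; first by rewrite mul0r expi0.
by rewrite -natr1 mulrDl mul1r expiD IHk exprSr.
Qed.

Lemma norm_expi t : `|expi t| = 1.
Proof. by rewrite normc_def /= cos2Dsin2 sqrtr1. Qed.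

Lemma sqr_norm_subr_expi t : `|1 - expi t| ^+ 2 = (2 - 2 * cos t)%:C.
Proof.
rewrite -add_Re2_Im2 /=; congr (_%:C).
by have := cos2Dsin2 t; rewrite !expr2 => h; lra.
Qed.

Definition fourier s f t : R[i] := \sum_(n <- s) (f n)%:C * expi (n%:~R * t).

(** The squared modulus of [fourier], kept real so that it can be
    differentiated and compared. *)
Definition energy s f t : R :=
  (\sum_(n <- s) f n * cos (n%:~R * t)) ^+ 2 +
  (\sum_(n <- s) f n * sin (n%:~R * t)) ^+ 2.

Lemma energy_ge0 s f t : 0 <= energy s f t.
Proof. by rewrite addr_ge0// sqr_ge0. Qed.

Lemma energy_fourier s f t : (energy s f t)%:C = `|fourier s f t| ^+ 2.
Proof.
suff -> : fourier s f t = (\sum_(n <- s) f n * cos (n%:~R * t)) +i*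
                          (\sum_(n <- s) f n * sin (n%:~R * t)).
  by rewrite -add_Re2_Im2.
rewrite /fourier; elim: s => [|n s IHs]; first by rewrite !big_nil.
by rewrite !big_cons IHs /expi; simpc.
Qed.

(** Reindexing by n = a - c: the window w need only contain the translate of the
    support, all its other points contributing zero. *)
Lemma sum_supp s w f (h : int -> R[i]) (c : int) :
  uniq s -> uniq w -> (forall n, n \notin s -> f n = 0) ->
  {in s, forall a, a - c \in w} ->
  \sum_(n <- w) (f (n + c))%:C * h n = \sum_(a <- s) (f a)%:C * h (a - c).
Proof.
move=> us uw f0 sw.
rewrite (bigID (fun n => n + c \in s)) /= [X in _ + X]big1 ?addr0; last first.
  by move=> n /f0 ->; rewrite mul0r.
rewrite -big_filter.
transitivity (\sum_(n <- [seq a - c | a <- s]) (f (n + c))%:C * h n).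
  apply: perm_big; apply: uniq_perm; first exact: filter_uniq.
    by rewrite map_inj_uniq// => x y /addIr.
  move=> n; rewrite mem_filter; apply/andP/mapP => [[nc _]|[a aS ->]].
    by exists (n + c) => //; rewrite addrK.
  by rewrite subrK aS sw.
by rewrite big_map; apply: eq_bigr => a _; rewrite subrK.
Qed.

(** A translation becomes multiplication by a character, so the alternating
    binomial sum of translations becomes a power of 1 - e^(it), by the binomial
    theorem. *)
Lemma fourier_forward_diff k s w f t :
  uniq s -> uniq w -> (forall n, n \notin s -> f n = 0) ->
  (forall a j, a \in s -> (j <= k)%N -> a - k%:Z + j%:Z \in w) ->
  fourier w (forward_diff k f) t =
  expi (- k%:R * t) * (1 - expi t) ^+ k * fourier s f t.
Proof.
move=> us uw f0 sw; rewrite /fourier /forward_diff.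
transitivity (\sum_(n <- w) \sum_(0 <= j < k.+1)
    ('C(k, j)%:R * (-1) ^+ j * f (n + k%:Z - j%:Z))%:C * expi (n%:~R * t)).
  by apply: eq_bigr => n _; rewrite rmorph_sum; exact: mulr_suml.
rewrite exchange_big /= exprBn [expi _ * _]mulr_sumr mulr_suml big_mkord.
apply: eq_bigr => j _.
transitivity ('C(k, j)%:R * (-1) ^+ j * \sum_(n <- w)
    (f (n + (k%:Z - j%:Z)))%:C * expi (n%:~R * t)).
  rewrite mulr_sumr; apply: eq_bigr => n _.
  by rewrite -addrA rmorphM rmorphM rmorph_nat rmorphXn rmorphN1 -!mulrA.
rewrite (sum_supp (s := s))//; last first.
  by move=> a aS; rewrite opprB addrA addrAC sw// -ltnS.
rewrite expr1n mulr1 -expi_natM -mulr_natl !mulr_sumr.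
apply: eq_bigr => a _.
have -> : (a - (k%:Z - j%:Z))%:~R * t = - k%:R * t + j%:R * t + a%:~R * t :> R.
  by rewrite !rmorphB/= -!pmulrn; ring.
by rewrite !expiD; ring.
Qed.

Lemma energy_forward_diff k s w f t :
  uniq s -> uniq w -> (forall n, n \notin s -> f n = 0) ->
  (forall a j, a \in s -> (j <= k)%N -> a - k%:Z + j%:Z \in w) ->
  energy w (forward_diff k f) t = (2 - 2 * cos t) ^+ k * energy s f t.
Proof.
move=> us uw f0 sw; apply: (@complexI R); rewrite energy_fourier.
rewrite (fourier_forward_diff t us uw f0 sw) rmorphM rmorphXn /=.
rewrite -sqr_norm_subr_expi energy_fourier !normrM normrX norm_expi mul1r.
by rewrite exprMn exprAC.
Qed.

End Fourier.

(** * Integrating the energy density *)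

Section Primitive.
Context {R : realType}.
Implicit Types (s w : seq int) (f g : int -> R) (t : R) (k : nat) (d : int).

Lemma energyE s f t :
  energy s f t = \sum_(m <- s) \sum_(n <- s) f m * f n * cos ((m - n)%:~R * t).
Proof.
rewrite /energy !expr2 !big_distrlr /= -big_split; apply: eq_bigr => m _.
rewrite -big_split; apply: eq_bigr => n _ /=.
by rewrite rmorphB /= mulrBl cosB; ring.
Qed.

Definition cos_primitive d t : R :=
  if d == 0 then t else sin (d%:~R * t) / d%:~R.

Lemma is_derive_cos_primitive d t :
  is_derive t 1 (cos_primitive d) (cos (d%:~R * t)).
Proof.
rewrite /cos_primitive; have [->|d0] := eqVneq d 0.
  by rewrite mul0r cos0; exact: is_derive_id.
have dR0 : (d%:~R : R) != 0 by rewrite intr_eq0.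
have e : is_derive t 1 (d%:~R \*: (@id R)) d%:~R.
  by apply: is_derive_eq; exact: mulr1.
rewrite (_ : (fun x => _) = (d%:~R)^-1 \*: (sin \o (d%:~R \*: (@id R)))); last first.
  by apply/funext => x /=; rewrite mulrC.
apply: (is_derive_eq (is_deriveZ _ (is_derive1_comp (is_derive_sin _) e))).
by rewrite /GRing.scale/= mulrC mulfK.
Qed.

Lemma cos_primitive0 d : cos_primitive d 0 = 0.
Proof. by rewrite /cos_primitive mulr0 sin0 mul0r if_same. Qed.

Lemma sin_natMpi k : sin (k%:R * pi) = 0 :> R.
Proof.
elim: k => [|k IHk]; first by rewrite mul0r sin0.
by rewrite -natr1 mulrDl mul1r sinDpi IHk oppr0.
Qed.

Lemma cos_primitive_pi d : cos_primitive d pi = if d == 0 then pi else 0.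
Proof.
rewrite /cos_primitive; case: eqP => // _.
suff -> : sin (d%:~R * pi) = 0 :> R by rewrite mul0r.
case: d => k; first exact: sin_natMpi.
by rewrite NegzE mulrNz mulNr sinN sin_natMpi oppr0.
Qed.

(** The integral of [energy s f] from 0 to t. *)
Definition energy_primitive s f t : R :=
  \sum_(m <- s) \sum_(n <- s) f m * f n * cos_primitive (m - n) t.

Lemma is_derive_bigsum (I : Type) (r : seq I) (F : I -> R -> R) (dF : I -> R) t :
  (forall i, is_derive t 1 (F i) (dF i)) ->
  is_derive t 1 (fun x => \sum_(i <- r) F i x) (\sum_(i <- r) dF i).
Proof.
move=> dFi; elim: r => [|i r IHr].
  rewrite big_nil (_ : (fun x => _) = cst 0); first exact: is_derive_cst.
  by apply/funext => x; rewrite big_nil.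
rewrite big_cons (_ : (fun x => _) = F i + (fun x => \sum_(j <- r) F j x)).
  exact: is_deriveD.
by apply/funext => x; rewrite big_cons.
Qed.

Lemma is_derive_energy_primitive s f t :
  is_derive t 1 (energy_primitive s f) (energy s f t).
Proof.
rewrite energyE; apply: is_derive_bigsum => m; apply: is_derive_bigsum => n.
by apply: is_deriveZ; exact: is_derive_cos_primitive.
Qed.

(** Parseval on the half period [0, pi]: as the density is an even function of
    t, this half already annihilates the off-diagonal terms. *)
Lemma energy_primitive_pi s f : uniq s ->
  energy_primitive s f pi = pi * \sum_(n <- s) f n ^+ 2.
Proof.
move=> us; rewrite mulr_sumr; apply: eq_big_seq => m ms.
rewrite (bigD1_seq m)//= subrr cos_primitive_pi eqxx big1 ?addr0; last first.
  by move=> n nm; rewrite cos_primitive_pi subr_eq0 eq_sym (negbTE nm) mulr0.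
by rewrite mulrC -expr2.
Qed.

Lemma energy_primitive0 s f : energy_primitive s f 0 = 0.
Proof.
rewrite /energy_primitive big1// => m _; rewrite big1// => n _.
by rewrite cos_primitive0 mulr0.
Qed.

(** Monotonicity of the integral over [a, b], in the form: the difference of the
    two primitives has a nonnegative derivative. *)
Lemma energy_primitive_le s w f g (c a b : R) : a <= b ->
  (forall t, a < t < b -> c * energy s f t <= energy w g t) ->
  c * (energy_primitive s f b - energy_primitive s f a) <=
  energy_primitive w g b - energy_primitive w g a.
Proof.
move=> ab le_cfg.
pose D x := energy_primitive w g x - c * energy_primitive s f x.
have dD (x : R) : is_derive x 1 D (energy w g x - c * energy s f x).
  have ? := is_derive_energy_primitive w g x.
  have ? := is_derive_energy_primitive s f x.
  by apply: is_deriveB; apply: is_deriveZ.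
suff : D a <= D b by rewrite /D; lra.
apply: (@ger0_derive1_le_cc R D a b) => //.
- by move=> x /= xab; rewrite derive1E derive_val subr_ge0 le_cfg// -in_itv.
- apply: continuous_subspaceT => x; apply: differentiable_continuous.
  by apply/derivable1_diffP; case: (dD x).
- by rewrite in_itv/= lexx.
- by rewrite in_itv/= lexx andbT.
Qed.

End Primitive.

(** * Support and size of a difference *)

Section Window.
Context {R : realType}.
Implicit Types (s : seq int) (f : int -> R) (k : nat).

(** [forward_diff k f n] reads f at n, ..., n + k, so it sees a point a of s
    exactly when n is one of a - k, ..., a. *)
Definition window k s : seq int :=
  undup [seq a - k%:Z + j%:Z | a <- s, j <- iota 0 k.+1].

Lemma uniq_window k s : uniq (window k s).
Proof. exact: undup_uniq. Qed.

Lemma size_window k s : (size (window k s) <= k.+1 * size s)%N.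
Proof.
by rewrite (leq_trans (size_undup _))// size_allpairs size_iota mulnC.
Qed.

Lemma mem_window k s a j : a \in s -> (j <= k)%N ->
  a - k%:Z + j%:Z \in window k s.
Proof.
move=> aS jk; rewrite mem_undup; apply/allpairsP; exists (a, j).
by rewrite mem_iota add0n ltnS.
Qed.

Lemma forward_diff_supp k s f : (forall n, n \notin s -> f n = 0) ->
  forall n, n \notin window k s -> forward_diff k f n = 0.
Proof.
move=> f0 n nw; rewrite /forward_diff big_mkord big1// => j _.
rewrite [f _]f0 ?mulr0//; apply: contra nw => nS.
have := mem_window nS (ltn_ord j : (j <= k)%N).
by rewrite (_ : _ + _ = n)//; ring.
Qed.

Lemma norm_forward_diff_le k f (b : R) n : (forall m, `|f m| <= b) ->
  `|forward_diff k f n| <= 2 ^+ k * b.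
Proof.
move=> fb; rewrite /forward_diff big_mkord.
have -> : 2 ^+ k * b = \sum_(j < k.+1) 'C(k, j)%:R * b.
  rewrite -mulr_suml; congr (_ * _); rewrite (_ : 2 = 1 + 1)// exprDn.
  by apply: eq_bigr => j _; rewrite !expr1n mulr1.
apply: (le_trans (ler_norm_sum _ _ _)); apply: ler_sum => j _.
rewrite !normrM normrX normrN1 expr1n mulr1 normr_nat.
by rewrite ler_wpM2l.
Qed.

End Window.

(** * The square-sum bound for sparse sets *)

Section Sparse.
Context {R : realType} (A : {fset int}).
Local Notation chiA := (chi A : int -> R).

Lemma chi_in n : n \in A -> chiA n = 1.
Proof. by move=> nA; rewrite /chi indicE mem_set. Qed.

Lemma chi_notin n : n \notin (A : seq int) -> chiA n = 0.
Proof. by move=> nA; rewrite /chi indicE memNset//; exact/negP. Qed.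

Lemma cos_primitive_pihalf_le (m n : int) :
  cos_primitive (m - n) (pi / 2) <=
  (if m == n then pi / 2 else 0)
  + (if m < n then ((n - m)%:~R)^-1 else 0)
  + (if n < m then ((m - n)%:~R)^-1 else 0) :> R.
Proof.
rewrite /cos_primitive subr_eq0.
have [mn|mn|_] := ltgtP m n; rewrite ?addr0 ?add0r//.
- rewrite -opprB mulrNz mulNr sinN invrN mulrNN.
  by rewrite ler_piMl ?sin_le1// invr_ge0 ler0z subr_ge0 ltW.
- by rewrite ler_piMl ?sin_le1// invr_ge0 ler0z subr_ge0 ltW.
Qed.

(** Half of the total mass pi |A| comes from the diagonal, and at most a quarter
    from the pairs m <> n: an unordered pair is counted twice, so the pairs
    give twice the sum that sparsity bounds by (pi/8) |A|. *)
Lemma energy_primitive_pihalf_le :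
  \sum_(m <- A) \sum_(n <- A | m < n) ((n - m)%:~R)^-1
    <= pi / 8 * #|` A|%:R :> R ->
  energy_primitive A chiA (pi / 2) <= 3 / 4 * pi * #|` A|%:R.
Proof.
move=> A_sparse.
have -> : energy_primitive A chiA (pi / 2) =
    \sum_(m <- A) \sum_(n <- A) cos_primitive (m - n) (pi / 2).
  apply: eq_big_seq => m mA; apply: eq_big_seq => n nA.
  by rewrite !chi_in// !mul1r.
apply: (@le_trans _ _ (\sum_(m <- A) \sum_(n <- A)
  ((if m == n then pi / 2 else 0)
  + (if m < n then ((n - m)%:~R)^-1 else 0)
  + (if n < m then ((m - n)%:~R)^-1 else 0)))).
  apply: ler_sum => m _; apply: ler_sum => n _.
  exact: cos_primitive_pihalf_le.
under eq_bigr do rewrite 2!big_split/=.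
rewrite 2!big_split/= [X in _ + X]exchange_big/=.
under [X in _ + X + _]eq_bigr do rewrite -big_mkcond/=.
under [X in _ + X]eq_bigr do rewrite -big_mkcond/=.
have -> : \sum_(m <- A) \sum_(n <- A) (if m == n then pi / 2 else 0)
    = pi / 2 * #|` A|%:R :> R.
  rewrite mulr_natr -[RHS]iter_addr_0 -count_predT -big_const_seq.
  apply: eq_big_seq => m mA.
  rewrite (bigD1_seq m)//= eqxx big1 ?addr0// => n nm.
  by rewrite eq_sym (negbTE nm).
by move: A_sparse; set S := \sum_(m <- _) _; set N := _%:R; lra.
Qed.

Lemma sum_sqr_forward_diff_chi_ge k :
  \sum_(m <- A) \sum_(n <- A | m < n) ((n - m)%:~R)^-1
    <= pi / 8 * #|` A|%:R :> R ->
  2 ^+ k / 4 * #|` A|%:R <=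
  \sum_(n <- window k A) forward_diff k chiA n ^+ 2.
Proof.
move=> A_sparse; set w := window k A; set g := forward_diff k chiA.
have pi0 : 0 < pi :> R := pi_gt0 R.
have gE t : energy w g t = (2 - 2 * cos t) ^+ k * energy A chiA t.
  apply: energy_forward_diff; rewrite ?fset_uniq ?uniq_window//.
  - exact: chi_notin.
  - by move=> a j; exact: mem_window.
(* The part of the energy over [0, pi/2] is only known to be nonnegative:
   compare it with the zero density. *)
have h1 : 0 <= energy_primitive w g (pi / 2).
  have := @energy_primitive_le R [::] w (cst 0) g 0 0 (pi / 2).
  rewrite !energy_primitive0 mul0r subr0; apply; first by lra.
  by move=> t _; rewrite mul0r energy_ge0.
(* Over [pi/2, pi] the cosine is nonpositive, so the factor 2 - 2 cos t is at
   least 2. *)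
have h2 : 2 ^+ k * (energy_primitive A chiA pi - energy_primitive A chiA (pi / 2))
    <= energy_primitive w g pi - energy_primitive w g (pi / 2).
  apply: energy_primitive_le; first by lra.
  move=> t /andP[t1 t2].
  have cost : cos t <= 0.
    rewrite -[t](subrK pi) cosDpi oppr_le0 cos_ge0_pihalf//.
    by apply/andP; split; lra.
  by rewrite gE ler_wpM2r ?energy_ge0// lerXn2r ?nnegrE//; lra.
have := energy_primitive_pihalf_le A_sparse.
move: h2; rewrite !energy_primitive_pi ?fset_uniq ?uniq_window//.
have -> : \sum_(n <- A) chiA n ^+ 2 = #|` A|%:R.
  rewrite -sum1_size natr_sum; apply: eq_big_seq => n nA.
  by rewrite chi_in// expr1n.
set S := \sum_(n <- w) _; set N := #|` A|%:R; set P := energy_primitive _ _ _.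
set Q := energy_primitive w g _ in h1 *.
move=> h2 h3; rewrite -(ler_pM2l pi0).
have : 2 ^+ k * (pi / 4 * N) <= 2 ^+ k * (pi * N - P).
  by rewrite ler_wpM2l ?exprn_ge0//; lra.
lra.
Qed.

End Sparse.

(** * Norms of finitely supported sequences *)

Section Norms.
Context {R : realType}.
Implicit Types (s w : seq int) (f g : int -> R) (p : R).

Local Open Scope classical_set_scope.

Lemma integral_counting_set1 (h : int -> R) (a : int) :
  (\int[@counting int R]_(x in [set a]) (h x)%:E = (h a)%:E)%E.
Proof.
transitivity (\int[@counting int R]_(x in [set a]) (cst (h a)%:E) x)%E.
  by apply: eq_integral => x; rewrite inE => ->.
rewrite integral_cst//= /counting asboolT//= fset_set1 cardfs1.
exact: mule1.
Qed.

Lemma lnorm_supp s f p : uniq s -> (forall n, n \notin s -> f n = 0) -> p != 0 ->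
  lnorm p f = ((\sum_(n <- s) `|f n| `^ p) `^ p^-1)%:E.
Proof.
move=> us f0 p0; rewrite /lnorm unlock -poweR_EFin; congr poweR.
pose h n : \bar R := (`|f n| `^ p)%:E.
transitivity (\int[@counting int R]_x h x)%E; first by [].
have Ds : \big[setU/set0]_(i <- s) [set i] = [set` s].
  by rewrite -bigcup_seq bigcup_imset1 image_id.
transitivity (\int[@counting int R]_(x in [set` s]) h x)%E.
  rewrite [RHS]integral_mkcond; apply: eq_integral => x _.
  rewrite patchE; case: ifPn => //; rewrite notin_setE => /negP xs.
  by rewrite /h f0// normr0 powR0.
rewrite -Ds (@ge0_integral_bigsetU _ _ _ _ _ (fun i => [set i]))//.
- by rewrite -sumEFin; apply: eq_bigr => i _; exact: integral_counting_set1.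
- by move=> i j _ _ [x [-> ->]].
- by move=> x _; rewrite lee_fin powR_ge0.
Qed.

Lemma lnorm_le s w f g p (c : R) : uniq s -> uniq w ->
  (forall n, n \notin s -> f n = 0) -> (forall n, n \notin w -> g n = 0) ->
  0 < p -> 0 <= c ->
  c `^ p * \sum_(n <- s) `|f n| `^ p <= \sum_(n <- w) `|g n| `^ p ->
  (c%:E * lnorm p f <= lnorm p g)%E.
Proof.
move=> us uw f0 g0 p0 c0 le_fg.
rewrite (lnorm_supp us f0) ?gt_eqF// (lnorm_supp uw g0) ?gt_eqF//.
have S0 (r : seq int) (h : int -> R) : 0 <= \sum_(n <- r) `|h n| `^ p.
  by apply: sumr_ge0 => n _; exact: powR_ge0.
rewrite -EFinM lee_fin -{1}[c]powRr1// -{1}(mulfV (lt0r_neq0 p0)) powRrM.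
rewrite -powRM ?powR_ge0//.
by rewrite ge0_ler_powR ?invr_ge0 ?(ltW p0)// nnegrE ?mulr_ge0 ?powR_ge0.
Qed.

(** The inequality of Young for the product of u and 1, cleared of its
    denominators. *)
Lemma bernoulli_powR (u q : R) : 0 <= u -> 1 <= q -> 1 + q * (u - 1) <= u `^ q.
Proof.
move=> u0; rewrite le_eqVlt => /predU1P[<-|q1]; first by rewrite powRr1//; lra.
have q0 : 0 < q by lra.
have qq : 0 < 1 - q^-1 by rewrite subr_gt0 invf_lt1.
have := @conjugate_powR R u 1 q (1 - q^-1)^-1 u0 ler01 q0.
rewrite invr_gt0 invrK => /(_ qq); rewrite mulr1 powR1 mul1r => h.
have {}h : u <= u `^ q / q + (1 - q^-1) by apply: h; ring.
rewrite -(ler_pM2l q0) in h.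
suff -> : u `^ q = q * (u `^ q / q + (1 - q^-1)) - q + 1 by lra.
by field; lra.
Qed.

(** The power mean inequality, proved by summing the tangent line inequality for
    u^(p/2) at u = 1, with u = (f n / l)^2. Its constant term 1 - p/2 is
    nonpositive, which is why a mere upper bound M on the number of points
    suffices. *)
Lemma sum_powR_ge s f p (l M : R) : 2 <= p -> 0 < l ->
  (size s)%:R <= M -> l ^+ 2 * M <= \sum_(n <- s) f n ^+ 2 ->
  l `^ p * M <= \sum_(n <- s) `|f n| `^ p.
Proof.
move=> p2 l0 sM sl.
have term n : l `^ p * (1 + p / 2 * (f n ^+ 2 / l ^+ 2 - 1)) <= `|f n| `^ p.
  have -> : `|f n| `^ p = l `^ p * (f n ^+ 2 / l ^+ 2) `^ (p / 2).
    rewrite -expr_div_n -real_normK ?num_real// -powR_mulrn// -powRrM.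
    rewrite (_ : 2%:R * (p / 2) = p); last by field.
    rewrite -powRM ?(ltW l0)//; congr (_ `^ _).
    by rewrite normf_div (gtr0_norm l0) mulrC divfK// gt_eqF.
  rewrite ler_wpM2l ?powR_ge0// bernoulli_powR//; last by lra.
  by rewrite divr_ge0// sqr_ge0.
apply: le_trans (ler_sum _ (fun n _ => term n)).
rewrite -mulr_sumr ler_wpM2l ?powR_ge0//.
rewrite big_split/= -mulr_sumr big_split/= -mulr_suml sumrN.
have -> : \sum_(n <- s) 1 = (size s)%:R :> R by rewrite -sum1_size natr_sum.
have : M <= (\sum_(n <- s) f n ^+ 2) / l ^+ 2.
  by rewrite ler_pdivlMr ?exprn_gt0// mulrC.
set S := _ / _; set N := _%:R in sM * => MS; nra.
Qed.

Lemma sum_powR_ge_bounded s f p (B : R) : 0 < p -> p <= 2 -> 0 < B ->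
  (forall n, `|f n| <= B) ->
  B `^ (p - 2) * \sum_(n <- s) f n ^+ 2 <= \sum_(n <- s) `|f n| `^ p.
Proof.
move=> p0 p2 B0 fB; rewrite mulr_sumr; apply: ler_sum => n _.
have [->|fn0] := eqVneq (f n) 0; first by rewrite expr0n mulr0 powR_ge0.
have nf0 : 0 < `|f n| by rewrite normr_gt0.
have -> : `|f n| `^ p = `|f n| `^ (p - 2) * f n ^+ 2.
  rewrite -real_normK ?num_real// -powR_mulrn// -powRD ?subrK//.
  by rewrite (lt0r_neq0 nf0) implybT.
rewrite ler_wpM2r ?sqr_ge0//.
rewrite -[p - 2]opprK opprB !powRN lef_pV2 ?posrE ?powR_gt0//.
by rewrite ge0_ler_powR ?nnegrE ?subr_ge0// ltW.
Qed.

End Norms.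

(** * All exponents *)

Theorem theorem6 (R : realType) (A : {fset int}) (A_neq0 : A != fset0)
    (A_sparse : \sum_(m <- A) \sum_(n <- A | m < n) ((n - m)%:~R)^-1
                  <= pi / 8 * #|` A|%:R :> R) :
  (forall (k : nat) (p : R), (0 < k)%N -> 2 <= p ->
     ((k.+1%:R `^ (p^-1 - 2^-1) * 2 `^ (k%:R / 2 - 1))%:E
        * lnorm p (chi A) <= lnorm p (forward_diff k (chi A)))%E) /\
  (forall (k : nat) (p : R), (0 < k)%N -> 1 <= p < 2 ->
     ((2 `^ (k%:R - (k%:R + 2) / p))%:E
        * lnorm p (chi A) <= lnorm p (forward_diff k (chi A)))%E).
Proof.
have l2 k := sum_sqr_forward_diff_chi_ge k A_sparse.
have reduce (k : nat) (p c : R) : 0 < p -> 0 <= c ->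
    c `^ p * #|` A|%:R <=
      \sum_(n <- window k A) `|forward_diff k (chi A) n| `^ p ->
    (c%:E * lnorm p (chi A) <= lnorm p (forward_diff k (chi A)))%E.
  move=> p0 c0 le_c.
  apply: (@lnorm_le R A (window k A)) => //; rewrite ?fset_uniq ?uniq_window//.
  - exact: chi_notin.
  - by apply: forward_diff_supp; exact: chi_notin.
  suff -> : \sum_(n <- A) `|chi A n| `^ p = #|` A|%:R :> R by [].
  rewrite -sum1_size natr_sum; apply: eq_big_seq => n nA.
  by rewrite chi_in// normr1 powR1.
have two0 : (2 : R) != 0 by rewrite pnatr_eq0.
split=> k p _.
- move=> p2; have p0 : 0 < p by lra.
  apply: reduce => //.
  have K0 : 0 < k.+1%:R :> R by rewrite ltr0n.
  (* The value of |f^(k)| if the lower bound for its square sum were spread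
     evenly over (k+1) |A| points. *)
  pose l : R := 2 `^ (k%:R / 2 - 1) * k.+1%:R `^ (- 2^-1).
  have l0 : 0 < l by rewrite mulr_gt0 ?powR_gt0.
  have -> : (k.+1%:R `^ (p^-1 - 2^-1) * 2 `^ (k%:R / 2 - 1)) `^ p * #|` A|%:R
      = l `^ p * (k.+1%:R * #|` A|%:R).
    rewrite powRD ?(lt0r_neq0 K0) ?implybT// -mulrA [_ * 2 `^ _]mulrC -/l.
    rewrite powRM ?powR_ge0 ?(ltW l0)// -powRrM mulVf ?gt_eqF// powRr1 ?ltW//.
    by rewrite [k.+1%:R * l `^ p]mulrC mulrA.
  apply: sum_powR_ge => //; first by rewrite -natrM ler_nat size_window.
  have -> : l ^+ 2 * (k.+1%:R * #|` A|%:R) = 2 ^+ k / 4 * #|` A|%:R.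
    rewrite exprMn -!powR_mulrn ?powR_ge0// -!powRrM mulNr mulVf//.
    rewrite powR_inv1 ?(ltW K0)// mulrBl divfK// mul1r powRB ?two0 ?implybT//.
    rewrite mulrA divfK ?lt0r_neq0// (_ : 2 `^ 2 = 4)// powR_mulrn//.
    by rewrite -natrX.
  exact: l2.
- move=> /andP[p1 p2]; have p0 : 0 < p by lra.
  apply: reduce; rewrite ?powR_ge0//.
  have := @sum_powR_ge_bounded R (window k A) (forward_diff k (chi A)) p (2 ^+ k).
  rewrite exprn_gt0// => /(_ p0 (ltW p2) isT) h.
  apply: le_trans (h _); last first.
    move=> n; rewrite -[leRHS]mulr1; apply: norm_forward_diff_le => m.
    have [mA|mA] := boolP (m \in (A : seq int)).
      by rewrite chi_in// normr1.
    by rewrite chi_notin// normr0.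
  rewrite -[X in X `^ (p - 2)]powR_mulrn// -!powRrM.
  have -> : (2 : R) `^ ((k%:R - (k%:R + 2) / p) * p) =
            2 `^ (k%:R * (p - 2)) * (2 ^+ k / 4).
    rewrite -powR_mulrn// (_ : 4 = 2 `^ 2%:R); last by rewrite powR_mulrn//; ring.
    rewrite -powRB ?two0 ?implybT// -powRD ?two0 ?implybT//; congr (_ `^ _).
    by field; rewrite lt0r_neq0.
  by rewrite -mulrA ler_wpM2l ?powR_ge0.
Qed.
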